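(* Let $T_P\sim\operatorname{Exp}(\mu)$ and $T_S\sim\operatorname{Exp}(\lambda_S)$ be independent, with rates $\mu,\lambda_S>0$, and let $\tau\ge 0$. Then $$\Pr\left(T_P<\min\{T_S,\tau\}\right)=\frac{\mu}{\mu+\lambda_S}\left(1-e^{-(\mu+\lambda_S)\tau}\right).$$ This probability is increasing in the deployment rate $\mu$ and in the window length $\tau$, and decreasing in the adversary substitution rate $\lambda_S$. More precisely, let $\tau\in[0,\bar\tau]$, let the protective benefit $B_{\lambda_S}$ satisfy $$0\le B_{\lambda_S}(\tau)\le K\Pr\left(T_P<\min\{T_S,\tau\}\right)\quad\text{and}\quad B_{\lambda_S}(0)=0,$$ where $K$ is a constant, and let the delay cost $C$ be continuous with $C(0)=0$ and $C(\tau)>0$ for every $\tau>0$. Then every maximizer of $B_{\lambda_S}(\tau)-C(\tau)$ over $\tau\in[0,\bar\tau]$ converges to zero as $\lambda_S\to\infty$.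
   Context: $\operatorname{Exp}(\lambda)$ denotes the exponential distribution with rate $\lambda$. $T_P$ is the random time at which selected defenders, given a model at time zero, finish deploying protection (deployment rate $\mu$); $T_S$ is the random time at which sophisticated adversaries obtain a substitute for the model (substitution rate $\lambda_S$); $\tau$ is the length of the defender-first window before public release, and $\bar\tau$ is the maximum window length. $B_{\lambda_S}$ and $C$ are real-valued functions on $[0,\bar\tau]$; $K$, $C$, $\mu$ and $\bar\tau$ do not depend on $\lambda_S$. *)

(* Defs.v *)
From HB Require Import structures.
From mathcomp Require Import all_boot all_order all_algebra.
From mathcomp Require Import all_classical all_reals all_analysis.

Set Implicit Arguments.
Unset Strict Implicit.
Unset Printing Implicit Defensive.

Import Order.TTheory GRing.Theory Num.Theory.
Import numFieldNormedType.Exports.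

Local Open Scope classical_set_scope.
Local Open Scope ring_scope.

(* exponential_prob is a probability measure only for rate > 0, so positivity
   of the rate has to be assumed separately. *)
Definition exponential_law (d : measure_display) (T : measurableType d)
    (R : realType) (P : probability T R) (X : {RV P >-> R}) (rate : R) : Prop :=
  forall V : set R, measurable V ->
    distribution P X V = exponential_prob rate V.

Definition independent_RV2 (d : measure_display) (T : measurableType d)
    (R : realType) (P : probability T R) (X Y : {RV P >-> R}) : Prop :=
  forall U V : set R, measurable U -> measurable V ->
    P (X @^-1` U `&` Y @^-1` V) = (P (X @^-1` U) * P (Y @^-1` V))%E.

Record exp_race (R : realType) (mu lambdaS : R) := ExpRace {
  race_disp : measure_display ;
  race_space : measurableType race_disp ;
  race_prob : probability race_space R ;
  T_P : {RV race_prob >-> R} ;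
  T_S : {RV race_prob >-> R} ;
  T_P_exponential : exponential_law T_P mu ;
  T_S_exponential : exponential_law T_S lambdaS ;
  T_P_T_S_independent : independent_RV2 T_P T_S }.

Definition protect_prob (R : realType) (mu lambdaS : R)
    (M : exp_race mu lambdaS) (tau : R) : \bar R :=
  race_prob M [set w | T_P M w < Num.min (T_S M w) tau].

Definition is_maximizer (R : realType) (D : set R) (f : R -> R) (t : R) : Prop :=
  D t /\ forall s, D s -> f s <= f t.

(* Main.v *)
(* Let F t be the probability and g t the claimed value. On {t <= T_P < t + h}
   the event {T_P < T_S} lies between {T_S >= t + h} and {T_S >= t}, so
   independence and the exponential tails bracket F (t + h) - F t. Hence
   |(F - g) (t + h) - (F - g) t| <= mu (mu + lambdaS) h^2, and adding up n steps
   of length t / n gives |F t - g t| = O(1 / n), without integrating against the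
   joint law. As for maximizers, one with t >= eps would satisfy
   min_[eps, taubar] C <= C t <= B t <= |K| mu / (mu + lambdaS),
   which fails for large lambdaS. *)

Require Import Defs.
From HB Require Import structures.
From mathcomp Require Import all_boot all_order all_algebra.
From mathcomp Require Import all_classical all_reals all_analysis.
From mathcomp Require Import measurable_realfun ring lra.

Set Implicit Arguments.
Unset Strict Implicit.
Unset Printing Implicit Defensive.

Import Order.TTheory GRing.Theory Num.Theory.
Import numFieldNormedType.Exports.

Local Open Scope classical_set_scope.
Local Open Scope ring_scope.

(** * Elementary exponential inequalities and monotonicity of the closed formula *)

Definition race_formula (R : realType) (mu lam t : R) : R :=
  mu / (mu + lam) * (1 - expR (- ((mu + lam) * t))).

(** From [1 + x <= expR x] one gets [x * expR (- x) <= 1 - expR (- x)], and [expR (- x) >= 1 - x]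
    then gives the lower bound. The quadratic gap between the two sides is what makes the error of
    one time step second order. *)
Lemma expRN_bounds (R : realType) (x : R) : 0 <= x ->
  x - x ^+ 2 <= 1 - expR (- x) <= x.
Proof.
move=> x0; apply/andP; split; last by have := expR_ge1Dx (- x); lra.
have := expR_ge1Dx x; have := expRxMexpNx_1 x; have := expR_gt0 (- x).
have := expR_ge1Dx (- x).
set u := expR (- x); set v := expR x => u1 u0 uv v1.
have uv1 : u * (1 + x) <= v * u by rewrite mulrC ler_pM2r.
have : x * (1 - x) <= x * u by rewrite ler_wpM2l.
nra.
Qed.

Lemma race_formula_lt_mu (R : realType) (mu1 mu2 lam t : R) :
  0 < mu1 -> mu1 < mu2 -> 0 < lam -> 0 < t ->
  race_formula mu1 lam t < race_formula mu2 lam t.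
Proof.
move=> mu10 mu12 lam0 t0; rewrite /race_formula.
(* Both factors of the formula increase strictly with the deployment rate. *)
apply: ltr_pM.
- by rewrite divr_ge0 // ltW //; lra.
- rewrite subr_ge0 -expR0 ler_expR; nra.
- rewrite ltr_pdivrMr ?addr_gt0 // mulrAC ltr_pdivlMr; [nra|lra].
- rewrite ltrD2l ltrN2 ltr_expR; nra.
Qed.

Lemma race_formula_lt_tau (R : realType) (mu lam t1 t2 : R) :
  0 < mu -> 0 < lam -> t1 < t2 ->
  race_formula mu lam t1 < race_formula mu lam t2.
Proof.
move=> mu0 lam0 t12; rewrite /race_formula ltr_pM2l; last first.
  by rewrite divr_gt0 // addr_gt0.
by rewrite ltrD2l ltrN2 ltr_expR ltrN2 ltr_pM2l ?addr_gt0.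
Qed.

(** This is the strict decrease of (1 - e^(-x)) / x, cross-multiplied. With u = e^(-a) and w =
    e^(-(b - a)), write 1 - e^(-b) = (1 - u) + u (1 - w), then use 1 - w < b - a and u a <= 1 -
    u. *)
Lemma expRN_slope_lt (R : realType) (a b : R) : 0 < a -> a < b ->
  (1 - expR (- b)) * a < (1 - expR (- a)) * b.
Proof.
move=> a0 ab.
have -> : - b = - a + - (b - a) by ring.
rewrite expRD.
have d0 : - (b - a) != 0 by rewrite oppr_eq0 subr_eq0 gt_eqF.
have := expR_gt1Dx d0; have := expR_ge1Dx a; have := expR_gt0 (- a).
have := expRxMexpNx_1 a.
set u := expR (- a); set v := expR a; set w := expR _ => uv u0 v1 w1.
have ua : u * (1 + a) <= v * u by rewrite mulrC ler_pM2r.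
have uaw : (u * a) * (1 - w) < (u * a) * (b - a).
  by rewrite ltr_pM2l ?mulr_gt0 //; lra.
nra.
Qed.

Lemma race_formula_gt_lam (R : realType) (mu lam1 lam2 t : R) :
  0 < mu -> 0 < lam1 -> lam1 < lam2 -> 0 < t ->
  race_formula mu lam2 t < race_formula mu lam1 t.
Proof.
move=> mu0 lam10 lam12 t0; rewrite /race_formula.
rewrite -!mulrA ltr_pM2l // mulrC [ltRHS]mulrC.
rewrite ltr_pdivrMr ?addr_gt0 //; last lra.
(* Multiplying by [t] turns the denominators [mu + lam1] and [mu + lam2] into the exponents, as the
   slope inequality requires. *)
rewrite mulrAC ltr_pdivlMr ?addr_gt0 // -(ltr_pM2r t0) -!mulrA.
apply: expRN_slope_lt; first by rewrite mulr_gt0 // addr_gt0.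
by rewrite ltr_pM2r //; lra.
Qed.

Lemma race_formula0 (R : realType) (mu lam : R) : race_formula mu lam 0 = 0.
Proof. by rewrite /race_formula mulr0 oppr0 expR0 subrr mulr0. Qed.

(** * Tails and interval probabilities of an exponential variable *)

Lemma exponential_prob_itvcy (R : realType) (rate a : R) : 0 < rate -> 0 <= a ->
  exponential_prob rate `[a, +oo[ = (expR (- (rate * a)))%:E.
Proof.
move=> rate0 a0; rewrite /exponential_prob.
have cexp : continuous (fun x : R => expR (- rate * x)).
  move=> z; apply: continuous_comp; last exact: continuous_expR.
  exact: mulrl_continuous.
(* Improper fundamental theorem of calculus: the antiderivative tends to 0 at infinity, so only its
   value at [a] remains. *)
rewrite (@ge0_continuous_FTC2y _ _ (fun x => - expR (- rate * x)) _ 0).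
- by rewrite EFinN oppeK add0e mulNr.
- by move=> x _; apply: exponential_pdf_ge0; exact: ltW.
- apply: (@continuous_subspaceW R^o _ _ [set` `[0, +oo[%R]).
    by apply: subset_itvr; rewrite bnd_simp.
  exact: within_continuous_exponential_pdf.
- rewrite -oppr0; apply: cvgN.
  rewrite (_ : (fun x => _) = (fun z => expR (- z)) \o (fun z => rate * z)).
    apply: (@cvg_comp _ _ _ _ _ _ (pinfty_nbhs R)); last exact: cvgr_expR.
    exact: gt0_cvgMry.
  by apply: eq_fun => x; rewrite mulNr.
- by move=> z _; exact: ex_derive.
- by apply: cvgN; apply/cvg_at_right_filter; exact: cexp.
- move=> z; rewrite in_itv/= andbT => az.
  by apply: derive1_exponential_pdf; rewrite in_itv/= andbT (le_lt_trans a0).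
Qed.

Section exponential_random_variable.
Context (d : measure_display) (T : measurableType d) (R : realType).
Variables (P : probability T R) (X : {RV P >-> R}) (rate : R).
Hypotheses (rate_gt0 : 0 < rate) (lawX : exponential_law X rate).

Lemma exponential_law_ge (a : R) : 0 <= a ->
  P (X @^-1` `[a, +oo[) = (expR (- (rate * a)))%:E.
Proof. by move=> a0; rewrite -exponential_prob_itvcy // -lawX. Qed.

Lemma exponential_law_itvco (a b : R) : 0 <= a -> a <= b ->
  P (X @^-1` `[a, b[) = (expR (- (rate * a)) - expR (- (rate * b)))%:E.
Proof.
move=> a0 ab; rewrite EFinB -!exponential_law_ge ?(le_trans a0) //.
have mX : forall U : set R, measurable U -> measurable (X @^-1` U).
  by move=> U mU; rewrite -[_ @^-1` _]setTI; exact: measurable_funP.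
have -> : X @^-1` `[a, +oo[ = X @^-1` `[a, b[ `|` X @^-1` `[b, +oo[.
  rewrite -preimage_setU; congr (_ @^-1` _); apply/seteqP; split => x /=;
    rewrite !in_itv /= !andbT; last by lra.
  by move=> ->; have [xb|bx] := ltP x b; [left|right].
rewrite measureU; [|exact: mX|exact: mX|].
  by rewrite addeK // fin_num_measure //; exact: mX.
rewrite -preimage_setI -(preimage_set0 X); congr (_ @^-1` _).
by apply/seteqP; split => x //=; rewrite !in_itv /= !andbT; lra.
Qed.

Lemma exponential_law_lt0 : P [set w | X w < 0] = 0%E.
Proof.
have -> : [set w | X w < 0] = ~` (X @^-1` `[0, +oo[).
  by apply/seteqP; split => w /=; rewrite in_itv /= andbT ltNge => /negP.
rewrite probability_setC ?exponential_law_ge ?mulr0 ?oppr0 ?expR0 ?subee //.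
by rewrite -[_ @^-1` _]setTI; exact: measurable_funP.
Qed.

End exponential_random_variable.

(** * The race probability by small time increments *)

Section race.
Context (d : measure_display) (T : measurableType d) (R : realType).
Variables (P : probability T R) (X Y : {RV P >-> R}) (mu lam : R).
Hypotheses (mu_gt0 : 0 < mu) (lam_gt0 : 0 < lam).
Hypotheses (lawX : exponential_law X mu) (lawY : exponential_law Y lam).
Hypothesis indepXY : independent_RV2 X Y.

Let E (t : R) : set T := [set w | X w < Num.min (Y w) t].
Let F (t : R) : R := fine (P (E t)).

Let mpre (Z : {RV P >-> R}) (U : set R) :
  measurable U -> measurable (Z @^-1` U).
Proof. by move=> mU; rewrite -[_ @^-1` _]setTI; exact: measurable_funP. Qed.

Let mltXY : measurable [set w | X w < Y w].
Proof.
have -> : [set w | X w < Y w] = (Y \- X) @^-1` `]0, +oo[.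
  by apply/seteqP; split => w /=; rewrite in_itv /= andbT subr_gt0.
by rewrite -[_ @^-1` _]setTI; apply: measurable_funB.
Qed.

Let measurable_E t : measurable (E t).
Proof.
have -> : E t = [set w | X w < Y w] `&` X @^-1` `]-oo, t[.
  by rewrite /E; apply/seteqP; split => w /=; rewrite in_itv /= lt_min => /andP.
by apply: measurableI => //; exact: mpre.
Qed.

Let FE t : P (E t) = (F t)%:E.
Proof. by rewrite fineK // fin_num_measure. Qed.

Let F0 : F 0 = 0.
Proof.
apply/eqP; rewrite eq_le fine_ge0 // andbT -lee_fin -FE.
(* The event at time 0 forces [X w < 0], which is null. *)
rewrite -[leRHS](exponential_law_lt0 mu_gt0 lawX) le_measure ?inE //.
  have -> : [set w | X w < 0] = X @^-1` `]-oo, 0[.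
    by apply/seteqP; split => w /=; rewrite in_itv.
  exact: mpre.
by move=> w /=; rewrite /E /= lt_min => /andP[].
Qed.

Let increment (t h : R) : 0 <= t -> 0 <= h ->
  (expR (- (mu * t)) - expR (- (mu * (t + h)))) * expR (- (lam * (t + h))) <=
    F (t + h) - F t <=
  (expR (- (mu * t)) - expR (- (mu * (t + h)))) * expR (- (lam * t)).
Proof.
move=> t0 h0; set q := expR (- (mu * t)) - _.
have th : t <= t + h by rewrite lerDl.
(* [D] is exactly what the event gains when the window grows from [t] to [t + h]. *)
pose D := X @^-1` `[t, t + h[ `&` [set w | X w < Y w].
have mD : measurable D by apply: measurableI => //; exact: mpre.
have EthE : E (t + h) = E t `|` D.
  apply/seteqP; split => w; rewrite /E /D /= in_itv /= !lt_min.
    by move=> /andP[-> Xth]; rewrite Xth; case: (ltP (X w) t) => ?; [left|right].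
  by move=> [/andP[-> Xt]|[/andP[_ ->] ->]//]; rewrite (lt_le_trans Xt).
have -> : F (t + h) - F t = fine (P D).
  rewrite /F EthE measureU //; last first.
    apply/seteqP; split => w //; rewrite /E /D /= in_itv /= lt_min; lra.
  by rewrite fineD ?fin_num_measure // addrC addKr.
(* Independence is used here only, on rectangles: [a := t + h] gives the lower bracket and [a := t]
   the upper one. *)
have prod a : 0 <= a ->
    P (X @^-1` `[t, t + h[ `&` Y @^-1` `[a, +oo[) =
    (q * expR (- (lam * a)))%:E.
  move=> a0; rewrite indepXY // (exponential_law_itvco mu_gt0) //.
  by rewrite (exponential_law_ge lam_gt0) // -EFinM.
rewrite -!lee_fin fineK ?fin_num_measure // -!prod ?(le_trans t0) //.
apply/andP; split; rewrite le_measure ?inE //.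
- by apply: measurableI; exact: mpre.
- move=> w /=; rewrite /D /= !in_itv /= andbT => -[/andP[tX Xth] ?].
  by rewrite tX Xth; split=> //; lra.
- by apply: measurableI; exact: mpre.
- move=> w /=; rewrite /D /= !in_itv /= andbT => -[/andP[tX Xth] ?].
  by rewrite tX Xth; split=> //; lra.
Qed.

Let g := race_formula mu lam.

(** With a = mu h, b = lam h and e = e^(-(mu + lam) t), the increments of [F] and of [g] both lie
    between e (a - a (a + b)) and e a. Since e <= 1, they differ by at most a (a + b). *)
Let increment_error (t h : R) : 0 <= t -> 0 <= h ->
  `|(F (t + h) - g (t + h)) - (F t - g t)| <= mu * (mu + lam) * h ^+ 2.
Proof.
move=> t0 h0.
have ml0 : 0 < mu + lam by rewrite addr_gt0.
have dg : g (t + h) - g t =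
    expR (- ((mu + lam) * t)) *
    (mu / (mu + lam) * (1 - expR (- ((mu + lam) * h)))).
  rewrite /g /race_formula (mulrDr (mu + lam)) opprD expRD.
  by field; rewrite gt_eqF.
set a := mu * h; set b := lam * h.
have [a0 b0] : 0 <= a /\ 0 <= b by rewrite !mulr_ge0 // ltW.
set e := expR (- ((mu + lam) * t)).
have e01 : 0 <= e <= 1.
  by rewrite expR_ge0 -[leRHS]expR0 ler_expR oppr_le0 mulr_ge0 // ltW.
have /andP[Flo Fhi] : e * (a - a * (a + b)) <= F (t + h) - F t <= e * a.
  have inc := increment t0 h0; rewrite !mulrDr !opprD !expRD -/a -/b in inc.
  move: inc (expRN_bounds b0) (expRN_bounds a0).
  have eE : e = expR (- (mu * t)) * expR (- (lam * t)).
    by rewrite -expRD /e mulrDl opprD.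
  set u := expR (- a); set v := expR (- b) => /andP[lo hi] /andP[_ v1] /andP[u0 u1].
  apply/andP; split.
    apply: (le_trans _ lo).
    rewrite [leRHS](_ : _ = e * ((1 - u) * v)); last by rewrite eE; ring.
    rewrite ler_wpM2l ?expR_ge0 //.
    have u2 : 0 <= 1 - u by rewrite subr_ge0 -[leRHS]expR0 ler_expR oppr_le0.
    (* (1 - u) v = (1 - u) - (1 - u) (1 - v), which is at least (a - a^2) - a b. *)
    have : (1 - u) * (1 - v) <= a * b.
      by rewrite ler_pM // subr_ge0 -[leRHS]expR0 ler_expR oppr_le0.
    lra.
  apply: (le_trans hi).
  rewrite [leLHS](_ : _ = e * (1 - u)); last by rewrite eE; ring.
  by rewrite ler_wpM2l ?expR_ge0.
have /andP[glo ghi] : e * (a - a * (a + b)) <= g (t + h) - g t <= e * a.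
  have ab0 : 0 <= a + b by rewrite addr_ge0.
  have /andP[w0 w1] := expRN_bounds ab0.
  have k0 : 0 <= mu / (mu + lam) by rewrite divr_ge0 // ltW.
  have kE : a = mu / (mu + lam) * (a + b).
    by rewrite /a /b; field; rewrite gt_eqF.
  rewrite dg -/e (mulrDl mu lam h) -/a -/b.
  apply/andP; split; rewrite ler_wpM2l ?expR_ge0 //.
    by have := ler_wpM2l k0 w0; rewrite mulrBr expr2 mulrA -kE.
  by rewrite [leRHS]kE ler_wpM2l.
have -> : mu * (mu + lam) * h ^+ 2 = a * (a + b) by rewrite /a /b; ring.
have c0 : 0 <= a * (a + b) by rewrite mulr_ge0 ?addr_ge0.
have : e * (a * (a + b)) <= a * (a + b) by rewrite ler_piMl //; case/andP: e01.
by rewrite ler_norml; lra.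
Qed.

Let error_bound (h : R) (n : nat) : 0 <= h ->
  `|F (n%:R * h) - g (n%:R * h)| <= n%:R * (mu * (mu + lam) * h ^+ 2).
Proof.
move=> h0; elim: n => [|n IHn].
  by rewrite !mul0r F0 /g race_formula0 subrr normr0.
have nh0 : 0 <= n%:R * h by rewrite mulr_ge0.
have := increment_error nh0 h0.
rewrite -natr1 !mulrDl !mul1r => inc.
rewrite -[X in `|X|](subrK (F (n%:R * h) - g (n%:R * h))) addrC.
by rewrite (le_trans (ler_normD _ _)) // lerD.
Qed.

Lemma race_probability (t : R) : 0 <= t ->
  P [set w | X w < Num.min (Y w) t] = (race_formula mu lam t)%:E.
Proof.
move=> t0; rewrite FE; congr _%:E; apply/eqP; rewrite -subr_eq0 -normr_le0.
set K := mu * (mu + lam) * t ^+ 2.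
(* n + 1 steps of length t / (n + 1), each with error K / (n + 1)^2; the successor keeps the divisor
   nonzero. *)
have bound n : `|F t - g t| <= K / n.+1%:R.
  have h0 : 0 <= t / n.+1%:R by rewrite divr_ge0.
  have := error_bound n.+1 h0.
  rewrite mulrC divfK ?pnatr_eq0 // => /le_trans -> //.
  have : n.+1%:R != 0 :> R by rewrite pnatr_eq0.
  rewrite /K; move: n.+1%:R => m m0.
  by rewrite le_eqVlt; apply/orP; left; apply/eqP; field.
apply/ler_addgt0Pl => eps eps0; rewrite addr0.
have [n nK] : exists n, K / eps < n.+1%:R.
  exists (Num.truncn (K / eps)); exact: truncnS_gt.
apply: (le_trans (bound n)).
by rewrite ler_pdivrMr // mulrC -ler_pdivrMr // ltW.
Qed.

End race.

(** * Back to the protection probability, and convergence of the maximizers *)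

Lemma race_formula_bounds (R : realType) (mu lam t : R) :
  0 < mu -> 0 < lam -> 0 <= t ->
  0 <= race_formula mu lam t <= mu / (mu + lam).
Proof.
move=> mu0 lam0 t0; have ml0 : 0 < mu + lam by rewrite addr_gt0.
have k0 : 0 <= mu / (mu + lam) by rewrite divr_ge0 // ltW.
rewrite mulr_ge0 //=; last first.
  by rewrite subr_ge0 -expR0 ler_expR oppr_le0 mulr_ge0 // ltW.
by rewrite ler_piMr // gerBl expR_ge0.
Qed.

Lemma protect_probE (R : realType) (mu lam : R) (M : exp_race mu lam) (t : R) :
  0 < mu -> 0 < lam -> 0 <= t ->
  protect_prob M t = (race_formula mu lam t)%:E.
Proof.
move=> mu0 lam0 t0.
exact: (race_probability mu0 lam0 (T_P_exponential M) (T_S_exponential M)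
  (T_P_T_S_independent M) t0).
Qed.

Theorem proposition5 (R : realType) :
  (* closed formula *)
  (forall (mu lambdaS : R) (M : exp_race mu lambdaS) (tau : R),
    0 < mu -> 0 < lambdaS -> 0 <= tau ->
    protect_prob M tau =
      (mu / (mu + lambdaS) * (1 - expR (- ((mu + lambdaS) * tau))))%:E)
  /\
  (* increasing in mu (at tau = 0 the probability is constant) *)
  (forall (mu1 mu2 lambdaS : R)
      (M1 : exp_race mu1 lambdaS) (M2 : exp_race mu2 lambdaS) (tau : R),
    0 < mu1 -> mu1 < mu2 -> 0 < lambdaS -> 0 <= tau ->
    (protect_prob M1 tau <= protect_prob M2 tau)%E /\
    (0 < tau -> (protect_prob M1 tau < protect_prob M2 tau)%E))
  /\
  (* increasing in tau *)
  (forall (mu lambdaS : R) (M : exp_race mu lambdaS) (tau1 tau2 : R),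
    0 < mu -> 0 < lambdaS -> 0 <= tau1 -> tau1 < tau2 ->
    (protect_prob M tau1 < protect_prob M tau2)%E)
  /\
  (* decreasing in lambdaS (at tau = 0 the probability is constant) *)
  (forall (mu lambdaS1 lambdaS2 : R)
      (M1 : exp_race mu lambdaS1) (M2 : exp_race mu lambdaS2) (tau : R),
    0 < mu -> 0 < lambdaS1 -> lambdaS1 < lambdaS2 -> 0 <= tau ->
    (protect_prob M2 tau <= protect_prob M1 tau)%E /\
    (0 < tau -> (protect_prob M2 tau < protect_prob M1 tau)%E))
  /\
  (* every maximizer of B_lambdaS - C on [0, taubar] tends to 0 *)
  (forall (mu taubar K : R)
      (M : forall lambdaS : R, 0 < lambdaS -> exp_race mu lambdaS)
      (B : R -> R -> R) (C : R -> R),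
    0 < mu -> 0 <= taubar ->
    (forall (lambdaS : R) (lambdaS_gt0 : 0 < lambdaS) (tau : R),
      tau \in `[0, taubar] ->
      0 <= B lambdaS tau /\
      ((B lambdaS tau)%:E <= K%:E * protect_prob (M lambdaS lambdaS_gt0) tau)%E) ->
    (forall lambdaS : R, 0 < lambdaS -> B lambdaS 0 = 0) ->
    {within `[0, taubar], continuous C} ->
    C 0 = 0 ->
    (forall tau : R, tau \in `[0, taubar] -> 0 < tau -> 0 < C tau) ->
    forall eps : R, 0 < eps ->
      \forall lambdaS \near +oo, forall t : R,
        is_maximizer `[0, taubar] (fun tau => B lambdaS tau - C tau) t ->
        `|t - 0| < eps).
Proof.
split; [|split; [|split; [|split]]].
- exact: protect_probE.
- move=> mu1 mu2 lam M1 M2 t mu10 mu12 lam0 t0.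
  rewrite !protect_probE ?(lt_trans mu10 mu12) // lee_fin lte_fin.
  split; last exact: race_formula_lt_mu.
  move: t0; rewrite le_eqVlt => /predU1P[<-|t0]; first by rewrite !race_formula0.
  exact/ltW/race_formula_lt_mu.
- move=> mu lam M t1 t2 mu0 lam0 t10 t12.
  rewrite !protect_probE ?(le_trans t10 (ltW t12)) // lte_fin.
  exact: race_formula_lt_tau.
- move=> mu lam1 lam2 M1 M2 t mu0 lam10 lam12 t0.
  rewrite !protect_probE ?(lt_trans lam10 lam12) // lee_fin lte_fin.
  split; last exact: race_formula_gt_lam.
  move: t0; rewrite le_eqVlt => /predU1P[<-|t0]; first by rewrite !race_formula0.
  exact/ltW/race_formula_gt_lam.
move=> mu taubar K M B C mu0 taubar0 BK B0 cC C0 C_gt0 eps eps0.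
(* If [taubar < eps], the whole window is already within [eps] of 0. Otherwise [[eps, taubar]] is
   nonempty and [C] attains a minimum on it. *)
have [taubar_eps|eps_taubar] := ltP taubar eps.
  near=> lam => t [/=]; rewrite in_itv /= => /andP[t0 tT] _.
  by rewrite subr0 ger0_norm // (le_lt_trans tT).
have sub : `[eps, taubar] `<=` `[0, taubar].
  by move=> x /=; rewrite !in_itv /=; lra.
have [c c_itv Cmin] := EVT_min eps_taubar (continuous_subspaceW sub cC).
(* [c] is chosen before [lam], so [C c] is a positive threshold common to all substitution rates. *)
have Cc0 : 0 < C c.
  by apply: C_gt0; [exact: sub|move: c_itv; rewrite in_itv /=; lra].
near=> lam => t [/= tT tmax]; rewrite subr0.
have lam0 : 0 < lam by near: lam; exact: nbhs_pinfty_gt.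
have t0 : 0 <= t by move: tT; rewrite in_itv => /andP[].
rewrite ger0_norm // ltNge; apply/negP => eps_t.
have Ct : C c <= C t.
  by apply: Cmin; move: tT; rewrite !in_itv /= eps_t => /andP[_ ->].
have zT : 0 \in `[0, taubar] by rewrite in_itv /= lexx.
(* The objective is 0 at the empty window, so a maximizer satisfies [C t <= B lam t]. *)
have := tmax 0 zT; rewrite B0 // C0 subrr => BC.
have [_] := BK lam lam0 t tT; rewrite protect_probE // -EFinM lee_fin => Bt.
have /andP[f0 f1] := race_formula_bounds mu0 lam0 t0.
(* This threshold makes [|K| * mu / (mu + lam)], a bound on the benefit uniform in [t], fall below
   [C c]. *)
have KCc : `|K| * mu / C c < lam.
  by near: lam; exact/nbhs_pinfty_gt/num_real.
(* The absolute value covers a negative [K], for which multiplication would reverse the upper bound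
   on the formula. *)
have Kf : K * race_formula mu lam t <= `|K| * (mu / (mu + lam)).
  by rewrite (le_trans (ler_wpM2r f0 (ler_norm K))) // ler_wpM2l.
have : `|K| * (mu / (mu + lam)) < C c.
  rewrite ltr_pdivrMr // in KCc.
  by rewrite mulrA ltr_pdivrMr ?addr_gt0 //; have := mulr_gt0 mu0 Cc0; lra.
lra.
Unshelve. all: by end_near. Qed.
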